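(* Let $T=A+\mathrm iB$ with $A$ uniformly positive and $B$ symmetric, and let $S$ be a linear operator with $\operatorname{dom}(A^{1/2})\subset\operatorname{dom}(S)$ such that $A^{-1/2}S$ is $A^{1/2}$-compact, i.e. $A^{-1/2}SA^{-1/2}$ is compact. Then $W_e(T)=W_e(T+S)$. In particular, if $S$ is $A$-compact and $\operatorname{dom}(A)\subset\operatorname{dom}(S)\cap\operatorname{dom}(S^* )$, then $W_e(T)=W_e(T+S)$.
   Context: $H$ is a separable infinite-dimensional complex Hilbert space. $A$ uniformly positive means $A$ is selfadjoint with $A\ge c>0$ for some constant $c$; $A^{1/2}$ is its positive square root. $T$ has domain $\operatorname{dom}(A)\cap\operatorname{dom}(B)$ and $T+S$ has domain $\operatorname{dom}(T)\cap\operatorname{dom}(S)$. $W_e(T)=\{\lambda:\exists x_n\in\operatorname{dom}(T),\|x_n\|=1,x_n\stackrel{w}{\to}0,\langle Tx_n,x_n\rangle\to\lambda\}$. An operator $R$ is $C$-compact if $\operatorname{dom}(C)\subset\operatorname{dom}(R)$ and $R$ maps sequences $(x_n)$ with $(x_n),(Cx_n)$ bounded to sequences with a convergent subsequence. *)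

(* Defs.v *)
From mathcomp Require Import all_boot all_algebra reals complex.
From Stdlib Require Import ClassicalEpsilon.
Set Implicit Arguments. Unset Strict Implicit. Unset Printing Implicit Defensive.
Import GRing.Theory Num.Theory.
Local Open Scope ring_scope.

Record InnerSpace (R : realType) := {
  isort :> lmodType R[i];
  inner : isort -> isort -> R[i];
  inner_linl : forall (a : R[i]) (x y z : isort),
      inner (a *: x + y) z = a * inner x z + inner y z;
  inner_conj : forall x y : isort, inner y x = conjc (inner x y);
  inner_ge0 : forall x : isort, 0 <= inner x x;
  inner_eq0 : forall x : isort, inner x x = 0 -> x = 0 }.

Section Norms.
Variables (R : realType) (H : InnerSpace R).

Definition hnorm (x : H) : R := Num.sqrt (complex.Re (inner x x)).

Definition hconv (u : nat -> H) (l : H) : Prop :=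
  forall e : R, 0 < e -> exists N : nat, forall n, (N <= n)%N -> hnorm (u n - l) < e.

Definition hcauchy (u : nat -> H) : Prop :=
  forall e : R, 0 < e -> exists N : nat, forall n m, (N <= n)%N -> (N <= m)%N ->
    hnorm (u n - u m) < e.

Definition hbounded (u : nat -> H) : Prop :=
  exists M : R, forall n, hnorm (u n) <= M.

Definition cconv (u : nat -> R[i]) (l : R[i]) : Prop :=
  forall e : R, 0 < e -> exists N : nat, forall n, (N <= n)%N -> `|u n - l| < (e%:C)%C.

Definition weak_to0 (u : nat -> H) : Prop :=
  forall y : H, cconv (fun n => inner (u n) y) 0.

Definition dense_set (D : H -> Prop) : Prop :=
  forall (x : H) (e : R), 0 < e -> exists y, D y /\ hnorm (x - y) < e.

End Norms.

Record Hilbert (R : realType) := {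
  hspace :> InnerSpace R;
  h_complete : forall u : nat -> hspace, hcauchy u -> exists l, hconv u l;
  h_separable : exists d : nat -> hspace, dense_set (fun y => exists n, y = d n);
  h_infdim : forall n : nat, exists v : 'I_n -> hspace,
      forall c : 'I_n -> R[i], \sum_(k < n) c k *: v k = 0 -> forall k, c k = 0 }.

Record op (R : realType) (H : Hilbert R) := mkop {
  dom : H -> Prop;
  app : H -> H }.

Section Ops.
Variables (R : realType) (H : Hilbert R).
Implicit Types (A B C S T : op H).

Definition linop T : Prop :=
  dom T 0 /\
  forall (a : R[i]) (x y : H), dom T x -> dom T y ->
    dom T (a *: x + y) /\ app T (a *: x + y) = a *: app T x + app T y.

Definition densely_defined T : Prop := dense_set (dom T).

Definition adj_dom T (y : H) : Prop :=
  exists z : H, forall x, dom T x -> inner (app T x) y = inner x z.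

Definition selfadjoint T : Prop :=
  linop T /\ densely_defined T /\
  (forall x y, dom T x -> dom T y -> inner (app T x) y = inner x (app T y)) /\
  (forall y z : H, (forall x, dom T x -> inner (app T x) y = inner x z) ->
      dom T y /\ app T y = z).

Definition op_symmetric T : Prop :=
  linop T /\ densely_defined T /\
  (forall x y, dom T x -> dom T y -> inner (app T x) y = inner x (app T y)).

Definition uniformly_positive A : Prop :=
  selfadjoint A /\
  exists c : R, 0 < c /\ forall x, dom A x -> ((c * hnorm x ^+ 2)%:C)%C <= inner (app A x) x.

Definition is_pos_sqrt Q A : Prop :=
  selfadjoint Q /\ (forall x, dom Q x -> 0 <= inner (app Q x) x) /\
  (forall x, dom A x <-> (dom Q x /\ dom Q (app Q x))) /\
  (forall x, dom A x -> app A x = app Q (app Q x)).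

Definition op_add S T : op H :=
  mkop (fun x => dom S x /\ dom T x) (fun x => app S x + app T x).

Definition op_AiB A B : op H :=
  mkop (fun x => dom A x /\ dom B x) (fun x => app A x + 'i *: app B x).

Definition op_comp (F G : op H) : op H :=
  mkop (fun x => dom G x /\ dom F (app G x)) (fun x => app F (app G x)).

(* inverse of an (injective) operator: domain is the range *)
Definition op_inv (Q : op H) : op H :=
  mkop (fun y => exists x, dom Q x /\ app Q x = y)
       (fun y => epsilon (inhabits (0 : H)) (fun x => dom Q x /\ app Q x = y)).

Definition rel_compact C (Rop : op H) : Prop :=
  (forall x, dom C x -> dom Rop x) /\
  forall u : nat -> H, (forall n, dom C (u n)) -> hbounded u ->
    hbounded (fun n => app C (u n)) ->
    exists phi : nat -> nat, (forall n, (phi n < phi n.+1)%N) /\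
      exists l : H, hconv (fun n => app Rop (u (phi n))) l.

Definition W_e T (lam : R[i]) : Prop :=
  exists x : nat -> H,
    (forall n, dom T (x n)) /\ (forall n, hnorm (x n) = 1) /\ weak_to0 x /\
    cconv (fun n => inner (app T (x n)) (x n)) lam.

End Ops.

(* Main.v *)
(* Put [s(u, v) = <S u, v>].  Everything reduces to the claim that [s(u_n, v_n) -> 0] whenever
   [u_n], [v_n] are bounded in the form norm [|A^{1/2} x|] and [u_n -> 0] weakly.  Indeed,
   since [<B x, x>] is real, a sequence realising a point of [W_e(T)] is form bounded; one
   realising a point of [W_e(T + S)] is form bounded too, for otherwise its normalisation in
   the form norm would tend to [0] and contradict the claim.

   If [A^{-1/2} S] is [A^{1/2}]-compact, the claim is [s(u, v) = <A^{-1/2} S u, A^{1/2} v>].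
   If [S] is [A]-compact with [dom A] inside [dom S^*], then [S^*] is [A]-bounded by uniform
   boundedness, and with the resolvents [J_e = (1 + e A)^-1] one writes
     [s(u, v) = s(J' u, J v) + s((1 - J') u, J v) + <(1 - J) S u, v>].
   The last term is uniformly small by interpolating the bound [|(1 - J) S x| <= d |A x|],
   where [d -> 0] by compactness, with the bound [|S^* (1 - J) y| <= b |A y|]; the second one
   is small as [|(1 - J') u|^2 <= e' |A^{1/2} u|^2], and the first tends to [0] by
   compactness of [S J']. *)

Require Import Defs.
From mathcomp Require Import all_boot all_order all_algebra reals complex.
From mathcomp Require Import ring lra.
From Stdlib Require Import Classical ClassicalEpsilon.
Set Implicit Arguments. Unset Strict Implicit. Unset Printing Implicit Defensive.
Import Order.TTheory GRing.Theory Num.Theory.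
Local Open Scope ring_scope.

(** * Elementary inequalities over the reals *)

Lemma exists_natr_gt (R : realType) (x : R) : exists n : nat, x < n%:R.
Proof. by exists (Num.truncn x).+1; apply: truncnS_gt. Qed.

Lemma natr_le_unbounded (R : realType) (a b : R) :
  (forall n : nat, n%:R * a <= b) -> a <= 0.
Proof.
move=> h; rewrite leNgt; apply/negP => a0.
have [n hn] := exists_natr_gt (b / a).
by move: (h n); rewrite leNgt mulrC -ltr_pdivrMl // mulrC hn.
Qed.

Lemma sqr_le_linear (R : realType) (x k : R) :
  0 <= x -> 0 <= k -> x ^+ 2 <= k * x -> x <= k.
Proof. by move=> x0 k0 h; rewrite leNgt; apply/negP => kx; nra. Qed.

(** For [c > 0] the quadratic is evaluated at its vertex [- b / c]; for [c = 0] it is affine in [t],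
    and a nonzero slope would make it negative somewhere. *)
Lemma discriminant_le (R : realType) (a b c : R) : 0 <= c ->
  (forall t : R, 0 <= a + 2 * t * b + t ^+ 2 * c) -> b ^+ 2 <= a * c.
Proof.
move=> c0 h; have [c00|cn0] := eqVneq c 0.
  have -> : b = 0.
    apply/eqP; apply: contraT => bn0.
    (* This [t] makes the affine function [a + 2 t b] equal to [-1]. *)
    have := h (- (a + 1) / (2 * b)); rewrite c00 mulr0 addr0.
    have -> : 2 * (- (a + 1) / (2 * b)) * b = - (a + 1) by field.
    by move=> ?; exfalso; lra.
  by rewrite c00 mulr0 expr2 mulr0.
have cp : 0 < c by rewrite lt_def cn0 c0.
have := h (- b / c).
have -> : a + 2 * (- b / c) * b + (- b / c) ^+ 2 * c = (a * c - b ^+ 2) / c by field.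
by rewrite pmulr_lge0 ?invr_gt0 // subr_ge0.
Qed.

(** * Inner product spaces as real ones *)

Section RealInner.
Variables (R : realType) (H : InnerSpace R).
Implicit Types (x y z : H) (a : R).

(* Estimates are made for the real part of the inner product; the imaginary part is
   recovered from it by replacing a vector [x] with [iscale x], see [inner_ext]. *)
Definition ip x y : R := complex.Re (inner x y).
Definition rscale a x : H := (a%:C)%C *: x.
Notation "a *r x" := (rscale a x) (at level 40).
Definition iscale x : H := 'i%C *: x.

Lemma innerDl x y z : inner (x + y) z = inner x z + inner y z.
Proof. by rewrite -[x]scale1r inner_linl mul1r scale1r. Qed.
Lemma inner0l z : inner 0 z = 0.
Proof. by apply: (addrI (inner 0 z)); rewrite -innerDl !addr0. Qed.
Lemma innerZl (c : R[i]) x z : inner (c *: x) z = c * inner x z.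
Proof. by rewrite -[c *: x]addr0 inner_linl inner0l addr0. Qed.

Lemma ipC x y : ip x y = ip y x.
Proof. by rewrite /ip inner_conj; case: (inner y x). Qed.
Lemma ipDl x y z : ip (x + y) z = ip x z + ip y z.
Proof. by rewrite /ip innerDl; case: (inner x z); case: (inner y z). Qed.
Lemma ipZl a x z : ip (a *r x) z = a * ip x z.
Proof. by rewrite /ip innerZl; case: (inner x z) => u v /=; rewrite mul0r subr0. Qed.
Lemma rscaleN1 x : (-1) *r x = - x.
Proof. by rewrite /rscale rmorphN1 scaleN1r. Qed.
Lemma ipNl x z : ip (- x) z = - ip x z.
Proof. by rewrite -rscaleN1 ipZl mulN1r. Qed.
Lemma ipBl x y z : ip (x - y) z = ip x z - ip y z.
Proof. by rewrite ipDl ipNl. Qed.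
Lemma ip0l z : ip 0 z = 0.
Proof. by rewrite /ip inner0l. Qed.
Lemma ipDr x y z : ip z (x + y) = ip z x + ip z y.
Proof. by rewrite ipC ipDl !(ipC z). Qed.
Lemma ipZr a x z : ip z (a *r x) = a * ip z x.
Proof. by rewrite ipC ipZl (ipC z). Qed.
Lemma ipNr x z : ip z (- x) = - ip z x.
Proof. by rewrite ipC ipNl (ipC z). Qed.
Lemma ipBr x y z : ip z (x - y) = ip z x - ip z y.
Proof. by rewrite ipDr ipNr. Qed.
Lemma ip_ge0 x : 0 <= ip x x.
Proof. by have := inner_ge0 x; rewrite lecE => /andP[_]. Qed.
Lemma ip_eq0 x : ip x x = 0 -> x = 0.
Proof.
move=> h; apply: inner_eq0; have := inner_ge0 x; move: h; rewrite /ip lecE.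
by case: (inner x x) => u v /= -> /andP[/eqP -> _].
Qed.

Lemma ip_iscalel x y : ip (iscale x) y = - complex.Im (inner x y).
Proof. by rewrite /ip innerZl; case: (inner x y) => u v /=; rewrite mul0r mul1r add0r. Qed.
Lemma ip_iscaler x y : ip x (iscale y) = complex.Im (inner x y).
Proof. by rewrite ipC ip_iscalel inner_conj; case: (inner x y) => u v /=; rewrite opprK. Qed.
Lemma inner_ext x y x' y' :
  ip x y = ip x' y' -> ip x (iscale y) = ip x' (iscale y') -> inner x y = inner x' y'.
Proof.
rewrite !ip_iscaler /ip; case: (inner x y) => u v; case: (inner x' y') => u' v' /=.
by move=> -> ->.
Qed.
Lemma iscaleK x : iscale (iscale x) = - x.
Proof. by rewrite /iscale scalerA -expr2 sqr_i scaleN1r. Qed.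
Lemma ip_iscale2 x y : ip (iscale x) (iscale y) = ip x y.
Proof. by rewrite ip_iscalel -ip_iscaler iscaleK ipNr opprK. Qed.

Lemma hnorm_sqr x : hnorm x ^+ 2 = ip x x.
Proof. by rewrite /hnorm sqr_sqrtr // ip_ge0. Qed.
Lemma hnorm_ge0 x : 0 <= hnorm x.
Proof. exact: sqrtr_ge0. Qed.
Lemma hnorm_le x a : 0 <= a -> (hnorm x <= a) = (ip x x <= a ^+ 2).
Proof. by move=> a0; rewrite -hnorm_sqr ler_sqr // nnegrE hnorm_ge0. Qed.
Lemma hnorm0 : hnorm (0 : H) = 0.
Proof. by rewrite /hnorm inner0l sqrtr0. Qed.
Lemma hnorm_eq0 x : hnorm x = 0 -> x = 0.
Proof. by move=> h; apply: ip_eq0; rewrite -hnorm_sqr h expr0n. Qed.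
Lemma hnormZ a x : hnorm (a *r x) = `|a| * hnorm x.
Proof.
apply/eqP; rewrite -(@eqrXn2 _ 2) ?mulr_ge0 ?hnorm_ge0 //.
by rewrite hnorm_sqr ipZl ipZr exprMn hnorm_sqr real_normK ?num_real // mulrA expr2.
Qed.
Lemma hnormN x : hnorm (- x) = hnorm x.
Proof. by rewrite -rscaleN1 hnormZ normrN1 mul1r. Qed.
Lemma hnorm_distC x y : hnorm (x - y) = hnorm (y - x).
Proof. by rewrite -opprB hnormN. Qed.

Lemma rscaleD a b x : (a + b) *r x = a *r x + b *r x.
Proof. by rewrite /rscale rmorphD scalerDl. Qed.
Lemma rscaleA a b x : a *r (b *r x) = (a * b) *r x.
Proof. by rewrite /rscale scalerA rmorphM. Qed.
Lemma rscale1 x : 1 *r x = x.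
Proof. by rewrite /rscale scale1r. Qed.
Lemma rscaleDr a x y : a *r (x + y) = a *r x + a *r y.
Proof. exact: scalerDr. Qed.
Lemma rscaleNr a x : a *r (- x) = - (a *r x).
Proof. exact: scalerN. Qed.

Lemma ip_sqr_le x y : ip x y ^+ 2 <= ip x x * ip y y.
Proof.
apply: discriminant_le => [|t]; first exact: ip_ge0.
have := ip_ge0 (x + t *r y); rewrite ipDl !ipDr !ipZl !ipZr (ipC y x).
by congr (_ <= _); ring.
Qed.
Lemma cauchy_schwarz x y : `|ip x y| <= hnorm x * hnorm y.
Proof.
rewrite -(@ler_pXn2r _ 2) ?nnegrE ?mulr_ge0 ?hnorm_ge0 //.
by rewrite real_normK ?num_real // exprMn !hnorm_sqr ip_sqr_le.
Qed.
Lemma ip_le x y : ip x y <= hnorm x * hnorm y.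
Proof. exact: le_trans (ler_norm _) (cauchy_schwarz x y). Qed.
Lemma ler_hnormD x y : hnorm (x + y) <= hnorm x + hnorm y.
Proof.
rewrite hnorm_le ?addr_ge0 ?hnorm_ge0 // ipDl !ipDr (ipC y x) -!hnorm_sqr.
by have := ip_le x y; nra.
Qed.
Lemma ler_hnormB x y : hnorm (x - y) <= hnorm x + hnorm y.
Proof. by rewrite -(hnormN y) ler_hnormD. Qed.
Lemma ler_hnorm_dist x y z : hnorm (x - z) <= hnorm (x - y) + hnorm (y - z).
Proof. by have := ler_hnormD (x - y) (y - z); rewrite addrA subrK. Qed.
Lemma ler_dist_hnorm x y : `|hnorm x - hnorm y| <= hnorm (x - y).
Proof.
rewrite ler_norml; apply/andP; split.
  by have := ler_hnormD (y - x) x; rewrite subrK hnorm_distC; lra.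
by have := ler_hnormD (x - y) y; rewrite subrK; lra.
Qed.

(** Testing with [v] close to [z] gives [|z|^2 <= a |z| + |z - v| (a + |z|)], whose last term can be
    made arbitrarily small. *)
Lemma dense_hnorm_le (D : H -> Prop) z a : dense_set D -> 0 <= a ->
  (forall v, D v -> ip v z <= a * hnorm v) -> hnorm z <= a.
Proof.
move=> dD a0 h; have z0 := hnorm_ge0 z.
apply: sqr_le_linear => //; apply/ler_addgt0Pr => e e0.
have d0 : 0 < e / (a + hnorm z + 1) by rewrite divr_gt0 //; lra.
have [v [Dv]] := dD z _ d0; rewrite ltr_pdivlMr; last by lra.
set w := hnorm (z - v) => hw.
have w0 : 0 <= w := hnorm_ge0 _.
have := h _ Dv; have := ip_le (z - v) z; have := ler_hnormB z (z - v).
rewrite opprB addrC subrK ipBl -hnorm_sqr -/w; nra.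
Qed.

End RealInner.
Notation "a *r x" := (rscale a x) (at level 40).

(** * Eventual properties and countable choice *)

Definition eventually (P : nat -> Prop) : Prop :=
  exists N : nat, forall n, (N <= n)%N -> P n.

Lemma eventually_and (P Q : nat -> Prop) :
  eventually P -> eventually Q -> eventually (fun n => P n /\ Q n).
Proof.
move=> [M hM] [N hN]; exists (maxn M N) => n; rewrite geq_max => /andP[h1 h2].
by split; [exact: hM | exact: hN].
Qed.
Lemma eventually_mono (P Q : nat -> Prop) :
  (forall n, P n -> Q n) -> eventually P -> eventually Q.
Proof. by move=> h [N hN]; exists N => n /hN /h. Qed.
Lemma eventually_ex (P : nat -> Prop) : eventually P -> exists n, P n.
Proof. by case=> N hN; exists N; apply: hN. Qed.
Lemma eventually_ge (N : nat) : eventually (fun n => (N <= n)%N).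
Proof. by exists N. Qed.

Lemma choice_nat (T : Type) (P : nat -> T -> Prop) :
  (forall n, exists x, P n x) -> exists f : nat -> T, forall n, P n (f n).
Proof.
move=> h; exists (fun n => proj1_sig (constructive_indefinite_description _ (h n))) => n.
by case: (constructive_indefinite_description _ (h n)).
Qed.

Lemma strictly_mono_ge (phi : nat -> nat) (n : nat) :
  (forall n, (phi n < phi n.+1)%N) -> (n <= phi n)%N.
Proof. by move=> h; elim: n => // n IH; apply: leq_ltn_trans (h n). Qed.

(** * Null and weakly null sequences *)

Section Null.
Variable R : realType.
Implicit Types f g : nat -> R.

Definition rnull f : Prop := forall e : R, 0 < e -> eventually (fun n => `|f n| < e).

Lemma rnull_le f g : (forall n, `|f n| <= `|g n|) -> rnull g -> rnull f.
Proof.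
by move=> h hg e /hg; apply: eventually_mono => n; apply: le_lt_trans (h n).
Qed.
Lemma rnullD f g : rnull f -> rnull g -> rnull (fun n => f n + g n).
Proof.
move=> hf hg e e0; have e2 : 0 < e / 2 by rewrite divr_gt0.
apply: eventually_mono (eventually_and (hf _ e2) (hg _ e2)) => n [h1 h2].
by apply: le_lt_trans (ler_normD _ _) _; lra.
Qed.
Lemma rnullZ (a : R) f : rnull f -> rnull (fun n => a * f n).
Proof.
move=> hf e e0; have ea : 0 < e / (`|a| + 1) by rewrite divr_gt0 // ltr_wpDl.
apply: eventually_mono (hf _ ea) => n; rewrite ltr_pdivlMr ?ltr_wpDl //.
by move=> h; rewrite normrM; apply: le_lt_trans h; have := normr_ge0 (f n); nra.
Qed.
Lemma rnullN f : rnull f -> rnull (fun n => - f n).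
Proof. by apply: rnull_le => n; rewrite normrN. Qed.
Lemma rnullB f g : rnull f -> rnull g -> rnull (fun n => f n - g n).
Proof. by move=> hf /rnullN; apply: rnullD. Qed.
Lemma rnull_bounded_mul f g (M : R) :
  rnull f -> (forall n, `|g n| <= M) -> rnull (fun n => f n * g n).
Proof.
move=> hf hg; apply: rnull_le (rnullZ M hf) => n; rewrite !normrM mulrC.
by apply: ler_wpM2r => //; apply: le_trans (hg n) (ler_norm _).
Qed.
Lemma rnull_approx f :
  (forall e : R, 0 < e -> exists2 g, rnull g & forall n, `|f n - g n| <= e) -> rnull f.
Proof.
move=> h e e0; have e2 : 0 < e / 2 by rewrite divr_gt0.
have [g hg hfg] := h _ e2.
apply: eventually_mono (hg _ e2) => n hn.
have := ler_normD (f n - g n) (g n); rewrite subrK; have := hfg n; lra.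
Qed.
Lemma rnull_harmonic : rnull (fun n => (n.+1%:R)^-1).
Proof.
move=> e e0; have [N hN] := exists_natr_gt e^-1.
exists N => n Nn; have n0 : 0 < n.+1%:R :> R by rewrite ltr0n.
rewrite ger0_norm ?invr_ge0 ?ler0n // invf_plt ?posrE //.
by apply: lt_le_trans hN _; rewrite ler_nat ltnW.
Qed.
Lemma not_rnull f : ~ rnull f ->
  exists2 e : R, 0 < e & forall N : nat, exists n, (N <= n)%N /\ e <= `|f n|.
Proof.
move=> nf; apply: NNPP => h; apply: nf => e e0; apply: NNPP => h2; apply: h.
exists e => // N; apply: NNPP => h3; apply: h2; exists N => n Nn.
by rewrite ltNge; apply/negP => h4; apply: h3; exists n.
Qed.
Lemma rnull_sub f (nu : nat -> nat) :
  (forall n, (n <= nu n)%N) -> rnull f -> rnull (fun n => f (nu n)).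
Proof.
move=> hnu hf e /hf[N hN]; exists N => n Nn; apply: hN.
exact: leq_trans (hnu n).
Qed.

Lemma cconvE (u : nat -> R[i]) (l : R[i]) :
  cconv u l <-> rnull (fun n => complex.Re (u n) - complex.Re l) /\
               rnull (fun n => complex.Im (u n) - complex.Im l).
Proof.
split.
  move=> h; split=> e /h[N hN]; exists N => n /hN; rewrite normc_def ltcR;
    (apply: le_lt_trans; rewrite -sqrtr_sqr ler_sqrt ?addr_ge0 ?sqr_ge0 //);
    case: (u n) => a b; case: l {h hN} => c d /=.
  - by rewrite lerDl sqr_ge0.
  - by rewrite lerDr sqr_ge0.
move=> [h1 h2] e e0; have e2 : 0 < e / 2 by rewrite divr_gt0.
apply: eventually_mono (eventually_and (h1 _ e2) (h2 _ e2)) => n.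
case: (u n) => a b; case: l {h1 h2} => c d /= [h1 h2].
rewrite normc_def ltcR /= -(ger0_norm (ltW e0)) -sqrtr_sqr ltr_sqrt ?exprn_gt0 //.
move: h1 h2; rewrite !ltr_norml => /andP[? ?] /andP[? ?]; nra.
Qed.
End Null.

Section WeakNull.
Variables (R : realType) (H : InnerSpace R).
Implicit Types (u : nat -> H).

Definition wnull u : Prop := forall y, rnull (fun n => ip (u n) y).

Lemma weak_to0E u : weak_to0 u <-> wnull u.
Proof.
split=> h y.
  by have [+ _] := (cconvE _ _).1 (h y); apply: rnull_le => n; rewrite subr0.
apply/cconvE; split; first by apply: rnull_le (h y) => n; rewrite subr0.
by apply: rnull_le (h (iscale y)) => n; rewrite subr0 ip_iscaler.
Qed.
Lemma wnull_sub u (nu : nat -> nat) :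
  (forall n, (n <= nu n)%N) -> wnull u -> wnull (fun n => u (nu n)).
Proof. by move=> hnu h y; apply: rnull_sub (h y). Qed.
Lemma wnull_of_norm u : rnull (fun n => hnorm (u n)) -> wnull u.
Proof.
move=> h y; apply: rnull_le (rnullZ (hnorm y) h) => n.
apply: le_trans (cauchy_schwarz _ _) _.
by rewrite [leRHS]ger0_norm ?mulr_ge0 ?hnorm_ge0 // mulrC.
Qed.
Lemma wnull_dense (D : H -> Prop) u : dense_set D -> hbounded u ->
  (forall y, D y -> rnull (fun n => ip (u n) y)) -> wnull u.
Proof.
move=> dD [M hM] h y; apply: rnull_approx => e e0.
have M0 : 0 <= M := le_trans (hnorm_ge0 _) (hM 0%N).
have d0 : 0 < e / (M + 1) by rewrite divr_gt0 //; lra.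
have [z [Dz]] := dD y _ d0; rewrite ltr_pdivlMr; last by lra.
move=> hz; exists (fun n => ip (u n) z); first exact: h.
move=> n; rewrite -ipBr; apply: le_trans (cauchy_schwarz _ _) _.
have := hM n; have := hnorm_ge0 (y - z); have := hnorm_ge0 (u n); nra.
Qed.
End WeakNull.

(** * Relatively compact operators *)

Section Compactness.
Variables (R : realType) (H : Hilbert R).
Implicit Types (C T : op H).

Definition linear_on (D : H -> Prop) (f : H -> H) : Prop :=
  forall (a : R[i]) (x y : H), D x -> D y -> f (a *: x + y) = a *: f x + f y.

Section LinearOn.
Variables (D : H -> Prop) (f : H -> H).
Hypotheses (D0 : D 0) (lf : linear_on D f).
Lemma linear_on0 : f 0 = 0.
Proof.
by have := lf 1 D0 D0; rewrite !scale1r addr0 => h; apply: (addrI (f 0)); rewrite addr0 -h.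
Qed.
Lemma linear_onD x y : D x -> D y -> f (x + y) = f x + f y.
Proof. by move=> Dx Dy; have := lf 1 Dx Dy; rewrite !scale1r. Qed.
Lemma linear_onZ (a : R[i]) x : D x -> f (a *: x) = a *: f x.
Proof. by move=> Dx; have := lf a Dx D0; rewrite !addr0 linear_on0 addr0. Qed.
Lemma linear_on_rscale a x : D x -> f (a *r x) = a *r f x.
Proof. exact: linear_onZ. Qed.
Lemma linear_on_iscale x : D x -> f (iscale x) = iscale (f x).
Proof. exact: linear_onZ. Qed.
Lemma linear_onB x y : D x -> D y -> f (x - y) = f x - f y.
Proof.
by move=> Dx Dy; rewrite addrC -scaleN1r lf // scaleN1r addrC.
Qed.
End LinearOn.

Lemma linop_linear_on T : linop T -> linear_on (dom T) (app T).
Proof. by move=> [_ h] a x y Dx Dy; case: (h a x y Dx Dy). Qed.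
Lemma dom0 T : linop T -> dom T 0.
Proof. by case. Qed.
Lemma domZD T (a : R[i]) x y : linop T -> dom T x -> dom T y -> dom T (a *: x + y).
Proof. by move=> [_ h] Dx Dy; case: (h a x y Dx Dy). Qed.
Lemma domD T x y : linop T -> dom T x -> dom T y -> dom T (x + y).
Proof. by move=> lT Dx Dy; have := domZD 1 lT Dx Dy; rewrite scale1r. Qed.
Lemma domZ T (a : R[i]) x : linop T -> dom T x -> dom T (a *: x).
Proof. by move=> lT Dx; have := domZD a lT Dx (dom0 lT); rewrite addr0. Qed.
Lemma domB T x y : linop T -> dom T x -> dom T y -> dom T (x - y).
Proof. by move=> lT Dx Dy; rewrite addrC -scaleN1r; apply: domZD. Qed.

(** If no constant worked, vectors normalised by [|x| + |C x|] would have images of norm above [n],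
    and no subsequence of these converges. *)
Lemma rel_compact_bound C T : linop C -> linear_on (dom C) (app T) -> rel_compact C T ->
  exists2 M : R, 0 <= M &
    forall x, dom C x -> hnorm (app T x) <= M * (hnorm x + hnorm (app C x)).
Proof.
move=> lC lT [_ hT]; apply: NNPP => hM.
have : forall n : nat, exists x, [/\ dom C x, hnorm x <= 1, hnorm (app C x) <= 1 &
    n%:R < hnorm (app T x)].
  move=> n; apply: NNPP => hn; apply: hM; exists n%:R; rewrite ?ler0n // => x Dx.
  rewrite leNgt; apply/negP => hx; apply: hn.
  have x0 := hnorm_ge0 x; have Cx0 := hnorm_ge0 (app C x).
  set s := hnorm x + hnorm (app C x) in hx.
  have s0 : 0 < s.
    rewrite lt_def addr_ge0 // andbT; apply/negP => /eqP s0.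
    have xz : x = 0 by apply: hnorm_eq0; rewrite /s in s0; lra.
    by move: hx; rewrite s0 mulr0 xz (linear_on0 (dom0 lC) lT) hnorm0 ltxx.
  have sV : `|s^-1| = s^-1 by rewrite ger0_norm ?invr_ge0 ?ltW.
  exists (s^-1 *r x); rewrite (linear_on_rscale (dom0 lC) (linop_linear_on lC)) //.
  rewrite (linear_on_rscale (dom0 lC) lT) // !hnormZ sV; split; first exact: domZ.
  - by rewrite ler_pdivrMl // mulr1 lerDl.
  - by rewrite ler_pdivrMl // mulr1 lerDr.
  - by rewrite ltr_pdivlMl // mulrC.
move=> /choice_nat[x hx].
have [|||phi [mphi [l hl]]] := hT x.
- by move=> n; case: (hx n).
- by exists 1 => n; case: (hx n).
- by exists 1 => n; case: (hx n).
have [N hN] := exists_natr_gt (hnorm l + 1).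
have [n [nN hn]] := eventually_ex (eventually_and (eventually_ge N) (hl 1 ltr01)).
have [_ _ _] := hx (phi n); have := ler_hnormD (app T (x (phi n)) - l) l; rewrite subrK.
have : N%:R <= (phi n)%:R :> R.
  by rewrite ler_nat (leq_trans nN) // strictly_mono_ge.
lra.
Qed.

(* If [T u_n] tended to [l != 0] along a subsequence, almost orthogonal terms could be
   summed up to some [s] of graph norm [O(sqrt k)] with [T s] within [k |l| / 2] of [k l]. *)
Lemma rel_compact_wnull C T (u : nat -> H) :
  linop C -> linear_on (dom C) (app T) -> rel_compact C T ->
  (forall n, dom C (u n)) -> hbounded u -> hbounded (fun n => app C (u n)) ->
  wnull u -> wnull (fun n => app C (u n)) -> rnull (fun n => hnorm (app T (u n))).
Proof.
move=> lC lT cT Du [M1 bu] [M2 bCu] wu wCu; apply: NNPP => /not_rnull[e e0].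
move=> /choice_nat[nu hnu].
have [M M0 hM] := rel_compact_bound lC lT cT.
case: cT => _ /(_ (fun n => u (nu n))) []; [by move=> n | by exists M1 | by exists M2 |].
move=> phi [mphi [l hl]].
pose v n := u (nu (phi n)).
have nuphi n : (n <= nu (phi n))%N.
  by apply: leq_trans (hnu _).1; apply: strictly_mono_ge.
have wv : wnull v by apply: (wnull_sub (u := u) nuphi).
have wCv : wnull (fun n => app C (v n)).
  exact: (wnull_sub (u := fun n => app C (u n)) nuphi).
have el : e <= hnorm l.
  apply/ler_addgt0Pr => d d0; have [n hn] := eventually_ex (hl d d0).
  have := (hnu (phi n)).2; rewrite ger0_norm ?hnorm_ge0 //.
  have := ler_hnormD (app T (u (nu (phi n))) - l) l; rewrite subrK; lra.
have e2 : 0 < e / 2 by rewrite divr_gt0.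
(* Adding one term raises [|s|^2] by at most [M1^2 + 2] and [|C s|^2] by at most [M2^2 + 2], where
   [2] bounds twice an inner product below [1]; [K] serves both. *)
have [K KE] : exists K, K = 2 + M1 ^+ 2 + M2 ^+ 2 by exists (2 + M1 ^+ 2 + M2 ^+ 2).
have sums (k : nat) : exists s, [/\ dom C s, ip s s <= k%:R * K,
    ip (app C s) (app C s) <= k%:R * K & hnorm (app T s - k%:R *r l) <= k%:R * (e / 2)].
  elim: k => [|k [s [Ds h1 h2 h3]]].
    exists 0; rewrite (linear_on0 (dom0 lC) lT) (linear_on0 (dom0 lC) (linop_linear_on lC)).
    by rewrite !mul0r !ip0l /rscale scale0r subr0 hnorm0; split => //; exact: dom0.
  have [n [[g1 g2] g3]] := eventually_ex (eventually_and (eventually_and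
    (wv s 1 ltr01) (wCv (app C s) 1 ltr01)) (hl _ e2)).
  exists (v n + s).
  rewrite (linear_onD (linop_linear_on lC) (Du _) Ds) (linear_onD lT (Du _) Ds).
  rewrite -natr1 mulrDl mul1r; split; first by apply: domD => //; exact: Du.
  - rewrite ipDl !ipDr (ipC s) -(hnorm_sqr (v n)); have := bu (nu (phi n)); rewrite -/(v n).
    move: g1; rewrite ltr_norml => /andP[_ ?].
    have h4 : hnorm (v n) <= M1 := bu _.
    have : hnorm (v n) ^+ 2 <= M1 ^+ 2.
      by rewrite lerXn2r ?nnegrE ?hnorm_ge0 ?(le_trans (hnorm_ge0 _) h4).
    by have := sqr_ge0 M2; lra.
  - rewrite ipDl !ipDr (ipC (app C s)) -(hnorm_sqr (app C (v n))).
    have := bCu (nu (phi n)); rewrite -/(v n).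
    move: g2; rewrite ltr_norml => /andP[_ ?].
    have h4 : hnorm (app C (v n)) <= M2 := bCu _.
    have : hnorm (app C (v n)) ^+ 2 <= M2 ^+ 2.
      by rewrite lerXn2r ?nnegrE ?hnorm_ge0 ?(le_trans (hnorm_ge0 _) h4).
    by have := sqr_ge0 M1; lra.
  - rewrite rscaleD rscale1 (addrC (_ *r l)) opprD addrACA.
    apply: le_trans (ler_hnormD _ _) _; rewrite mulrDl mul1r [leRHS]addrC.
    by apply: lerD => //; exact: ltW.
have K0 : 0 <= K by have := sqr_ge0 M1; have := sqr_ge0 M2; lra.
suff : e ^+ 2 <= 0 by rewrite leNgt exprn_gt0.
(* Here [k e / 2 <= |T s| <= M (|s| + |C s|)] with both norms at most [sqrt (k K)]; squaring yields
   [k e^2 <= 16 M^2 K] for every [k]. *)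
apply: (@natr_le_unbounded _ _ (16 * M ^+ 2 * K)) => -[|k].
  by rewrite mul0r mulr_ge0 ?mulr_ge0 ?sqr_ge0 ?ler0n.
have k0 : 0 < k.+1%:R :> R by rewrite ltr0n.
have [s [Ds h1 h2 h3]] := sums k.+1.
move: (k.+1%:R : R) k0 h1 h2 h3 => r r0 h1 h2 h3.
have h4 := hM _ Ds.
have h5 : r * e <= hnorm (app T s) + r * (e / 2).
  have := ler_hnormB (app T s) (app T s - r *r l); rewrite opprB addrC subrK hnormZ gtr0_norm //.
  nra.
have h6 : r * (e / 2) <= M * (hnorm s + hnorm (app C s)) by lra.
have h7 : (r * (e / 2)) ^+ 2 <= (M * (hnorm s + hnorm (app C s))) ^+ 2.
  rewrite ler_sqr // nnegrE; first by rewrite mulr_ge0 // ltW.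
  by rewrite mulr_ge0 // addr_ge0 ?hnorm_ge0.
have h8 : (hnorm s + hnorm (app C s)) ^+ 2 <= 4 * (r * K).
  rewrite -!hnorm_sqr in h1 h2; have := sqr_ge0 (hnorm s - hnorm (app C s)); nra.
rewrite exprMn in h7; have h9 := ler_wpM2l (sqr_ge0 M) h8.
rewrite -(ler_pM2l r0); have : (r * (e / 2)) ^+ 2 * 4 = r * (r * e ^+ 2) by field.
by move=> <-; nra.
Qed.
End Compactness.

Lemma bounded_of_eventually (R : realType) (f : nat -> R) (M : R) :
  eventually (fun n => f n <= M) -> exists M', forall n, f n <= M'.
Proof.
case=> N; elim: N M => [|N IH] M hM; first by exists M => n; apply: hM.
apply: (IH (Num.max M (f N))) => n; rewrite leq_eqVlt => /orP[/eqP <-|/hM h].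
  by rewrite le_max lexx orbT.
by rewrite le_max h.
Qed.

(** * Reduction to form compactness *)

Section Perturbation.
Variables (R : realType) (H : Hilbert R).
Implicit Types (A B S T : op H) (u v x : nat -> H).

Definition form_bounded A u : Prop :=
  (forall n, dom A (u n)) /\ exists M : R, forall n, ip (app A (u n)) (u n) <= M.

(* Compactness of [A^{-1/2} S A^{-1/2}], expressed without square roots. *)
Definition form_compact A S : Prop :=
  forall u v, form_bounded A u -> form_bounded A v -> wnull u ->
    rnull (fun n => ip (app S (u n)) (v n)).

Lemma form_bounded_iscale A u : linop A -> form_bounded A u ->
  form_bounded A (fun n => iscale (u n)).
Proof.
move=> lA [Du [M hM]]; split=> [n|]; first exact: domZ.
exists M => n; rewrite (linear_on_iscale (dom0 lA) (linop_linear_on lA)) //.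
by rewrite ip_iscale2.
Qed.

Lemma inner_real (y z : H) : inner y z = inner z y -> complex.Im (inner y z) = 0.
Proof.
move=> h; have := inner_conj y z; rewrite -h; case: (inner y z) => a b [] /=.
by move=> hb; lra.
Qed.

Lemma Re_inner_AiB A B (y : H) :
  inner (app B y) y = inner y (app B y) ->
  ip (app (op_AiB A B) y) y = ip (app A y) y.
Proof.
move=> /inner_real hB; rewrite /= ipDl -[RHS]addr0; congr (_ + _).
by rewrite -complexiE ip_iscalel hB oppr0.
Qed.

Lemma cconvD_null (f g : nat -> R[i]) (l : R[i]) :
  rnull (fun n => complex.Re (g n)) -> rnull (fun n => complex.Im (g n)) ->
  cconv f l -> cconv (fun n => f n + g n) l.
Proof.
move=> g1 g2 /cconvE[f1 f2]; apply/cconvE; split.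
  apply: rnull_le (rnullD f1 g1) => n; case: (f n) => a b; case: (g n) => c d /=.
  by rewrite addrAC.
apply: rnull_le (rnullD f2 g2) => n; case: (f n) => a b; case: (g n) => c d /=.
by rewrite addrAC.
Qed.

Lemma W_e_form_compact A B S : linop A -> op_symmetric B -> linop S ->
  (forall y, dom A y -> dom S y) -> form_compact A S ->
  forall lam, W_e (op_AiB A B) lam <-> W_e (op_add (op_AiB A B) S) lam.
Proof.
move=> lA [_ [_ sB]] lS AS kS lam.
have null_S x : form_bounded A x -> wnull x ->
    rnull (fun n => complex.Re (inner (app S (x n)) (x n))) /\
    rnull (fun n => complex.Im (inner (app S (x n)) (x n))).
  move=> bx wx; split; first exact: kS.
  (* The imaginary part of [<S x, x>] is the real part of [<S x, i x>], and [i x] is form bounded as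
     well. *)
  apply: rnull_le (kS _ _ bx (form_bounded_iscale lA bx) wx) => n.
  by rewrite ip_iscaler.
split=> -[x [Dx [x1 [/weak_to0E wx cx]]]]; exists x.
- have bx : form_bounded A x.
    split=> [n|]; first by case: (Dx n).
    have [+ _] := (cconvE _ _).1 cx => /(_ 1 ltr01) h.
    apply: (@bounded_of_eventually _ _ (complex.Re lam + 1)).
    apply: eventually_mono h => n; have [_ DB] := Dx n.
    rewrite -/(ip _ _) Re_inner_AiB ?sB //.
    by rewrite ltr_norml => /andP[_ ?]; lra.
  have [g1 g2] := null_S x bx wx; split; [|split; [|split]] => //.
  + by move=> n; have [DA DB] := Dx n; split => //; apply: AS.
  + exact/weak_to0E.
  + have := cconvD_null g1 g2 cx.
    by move=> h e /h[N hN]; exists N => n /hN; rewrite -innerDl.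
have lSA : linear_on (dom A) (app S).
  by move=> a y z /AS Dy /AS Dz; apply: (linop_linear_on lS).
have bx : form_bounded A x.
  split=> [n|]; first by case: (Dx n) => [[]].
  have [+ _] := (cconvE _ _).1 cx => /(_ 1 ltr01) h.
  have {h}[M hM] : exists M, forall n, ip (app A (x n)) (x n) + ip (app S (x n)) (x n) <= M.
    apply: (@bounded_of_eventually _ _ (complex.Re lam + 1)).
    apply: eventually_mono h => n; have [[_ DB] _] := Dx n.
    rewrite -/(ip _ _) ipDl Re_inner_AiB ?sB //.
    by rewrite ltr_norml => /andP[_ ?]; lra.
  (* Otherwise some terms have form value above [(k + 1)^2]; normalising them in the form norm gives
     [y k] with [|y k| = 1 / r k <= 1 / (k + 1)], a null sequence. *)
  apply: NNPP => nb.
  have : forall k : nat, exists n, k.+1%:R ^+ 2 < ip (app A (x n)) (x n).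
    move=> k; apply: NNPP => hk; apply: nb; exists (k.+1%:R ^+ 2) => n.
    by rewrite leNgt; apply/negP => ?; apply: hk; exists n.
  move=> /choice_nat[nu hnu].
  pose r k := Num.sqrt (ip (app A (x (nu k))) (x (nu k))).
  have k0 k : 0 < k.+1%:R :> R by rewrite ltr0n.
  have q0 k : 0 < ip (app A (x (nu k))) (x (nu k)).
    by apply: lt_trans (hnu k); rewrite exprn_gt0.
  have r0 k : 0 < r k by rewrite /r sqrtr_gt0.
  have r2 k : r k ^+ 2 = ip (app A (x (nu k))) (x (nu k)) by rewrite sqr_sqrtr // ltW.
  have DA n : dom A (x n) by case: (Dx n) => [[]].
  pose y k := (r k)^-1 *r x (nu k).
  have by1 : form_bounded A y.
    split=> [k|]; first exact: domZ.
    exists 1 => k; rewrite (linear_on_rscale (dom0 lA) (linop_linear_on lA)) // ipZl ipZr.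
    by rewrite -r2 mulrA -expr2 -exprMn mulVf ?expr1n // lt0r_neq0.
  have wy : wnull y.
    apply: wnull_of_norm; apply: rnull_le (@rnull_harmonic R) => k.
    rewrite !ger0_norm ?hnorm_ge0 ?invr_ge0 ?ler0n // hnormZ x1 mulr1.
    rewrite ger0_norm ?invr_ge0 ?(ltW (r0 k)) // lef_pV2 ?posrE //.
    by rewrite -(@ler_pXn2r _ 2) ?nnegrE ?ler0n ?(ltW (r0 k)) // r2 ltW.
  (* Eventually [Re <S y, y> > -1/2]; scaled back this gives [r k ^ 2 / 2 <= M], against
     [r k ^ 2 > N > 2 M]. *)
  have h2 : 0 < 1 / 2 :> R by lra.
  have [N hN] := exists_natr_gt (2 * M).
  have [k [kN]] := eventually_ex (eventually_and (eventually_ge N) (kS _ _ by1 by1 wy _ h2)).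
  rewrite (linear_on_rscale (dom0 lA) lSA) // ipZl ipZr mulrA -expr2 ltr_norml => /andP[h _].
  have := hM (nu k); have := hnu k; rewrite -r2.
  have : ip (app S (x (nu k))) (x (nu k)) =
    r k ^+ 2 * (((r k)^-1) ^+ 2 * ip (app S (x (nu k))) (x (nu k))).
    by rewrite mulrA -exprMn mulfV ?expr1n ?mul1r // lt0r_neq0.
  move: h; set s := _ ^+ 2 * ip _ _ => h ->.
  have kk : N%:R <= k.+1%:R ^+ 2 :> R.
    rewrite -natrX ler_nat; apply: leq_trans kN _; apply: leq_trans (leqnSn k) _.
    by rewrite expnS expn1 leq_pmulr.
  have := exprn_gt0 2 (r0 k); nra.
have [g1 g2] := null_S x bx wx; split; [|split; [|split]] => //.
+ by move=> n; case: (Dx n).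
+ exact/weak_to0E.
+ have h1 : rnull (fun n => complex.Re (- inner (app S (x n)) (x n))).
    by apply: rnull_le g1 => n; case: (inner _ _) => a b /=; rewrite normrN.
  have h2 : rnull (fun n => complex.Im (- inner (app S (x n)) (x n))).
    by apply: rnull_le g2 => n; case: (inner _ _) => a b /=; rewrite normrN.
  have := cconvD_null h1 h2 cx.
  by move=> h e /h[N hN]; exists N => n /hN; rewrite [app (op_add _ _) _]/= innerDl addrK.
Qed.
End Perturbation.

(** * The square root of [A] and form compactness *)

Section SquareRoot.
Variables (R : realType) (H : Hilbert R).
Implicit Types (A S Q : op H).

Definition coercive A (c : R) : Prop :=
  0 < c /\ forall x, dom A x -> c * hnorm x ^+ 2 <= ip (app A x) x.

Lemma uniformly_positive_coercive A : uniformly_positive A -> exists c, coercive A c.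
Proof.
by move=> [_ [c [c0 h]]]; exists c; split=> // x /h; rewrite lecE => /andP[].
Qed.

Lemma selfadjoint_ip A x y : selfadjoint A -> dom A x -> dom A y ->
  ip (app A x) y = ip x (app A y).
Proof. by move=> [_ [_ [h _]]] Dx Dy; rewrite /ip h. Qed.

Lemma hbounded_of_sqr (u : nat -> H) (a M : R) : 0 < a ->
  (forall n, a * hnorm (u n) ^+ 2 <= M) -> hbounded u.
Proof.
move=> a0 h; exists (M / a + 1) => n; have := h n.
rewrite mulrC -ler_pdivlMr // => hn; rewrite leNgt; apply/negP => ?.
by have := hnorm_ge0 (u n); nra.
Qed.

(** With [X = Q^-1 S] on [dom Q] one has [<S u, v> = <X u, Q v>]; here [Q v_n] is bounded, and
    [X u_n -> 0] in norm because [Q u_n] is weakly null along with [u_n]. *)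
Lemma form_compact_sqrt A S Q : uniformly_positive A -> is_pos_sqrt Q A -> linop S ->
  (forall x, dom Q x -> dom S x) -> rel_compact Q (op_comp (op_inv Q) S) ->
  form_compact A S.
Proof.
move=> pA [sQ [_ [QA AQ]]] lS QS cR u v [Du [M hM]] [Dv [M' hM']] wu.
have [c [c0 cA]] := uniformly_positive_coercive pA.
have [lA _] := pA.1; have lQ := sQ.1.
have q2 x : dom A x -> ip (app A x) x = hnorm (app Q x) ^+ 2.
  move=> Dx; have [DQ DQQ] := (QA x).1 Dx.
  by rewrite AQ // hnorm_sqr -selfadjoint_ip.
(* A vector killed by [Q] lies in [dom A], where coercivity makes it zero. Injectivity is what makes
   the preimages chosen by [op_inv] linear. *)
have injQ x y : dom Q x -> dom Q y -> app Q x = app Q y -> x = y.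
  move=> Dx Dy e; have D := domB lQ Dx Dy.
  have Q0 : app Q (x - y) = 0 by rewrite (linear_onB (linop_linear_on lQ)) // e subrr.
  have DA : dom A (x - y) by apply/QA; rewrite Q0; split => //; exact: dom0.
  have := cA _ DA; rewrite q2 // Q0 hnorm0 expr0n /= => h.
  apply/eqP; rewrite -subr_eq0; apply/eqP; apply: hnorm_eq0; apply/eqP.
  by rewrite -sqrf_eq0 eq_le sqr_ge0 andbT -(ler_pM2l c0) mulr0.
have DQ x : dom A x -> dom Q x by move=> /QA[].
have RQ x : dom Q x -> dom Q (app (op_comp (op_inv Q) S) x) /\
    app Q (app (op_comp (op_inv Q) S) x) = app S x.
  by move=> /(cR.1 x)[_ h]; apply: (epsilon_spec (inhabits (0 : H)) _ h).
have lR : linear_on (dom Q) (app (op_comp (op_inv Q) S)).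
  move=> a x y Dx Dy.
  have [Dz ez] := RQ _ (domZD a lQ Dx Dy); have [Dx' ex] := RQ _ Dx; have [Dy' ey] := RQ _ Dy.
  apply: injQ => //; first exact: domZD.
  by rewrite ez !linop_linear_on // ?ex ?ey //; apply: QS.
have bQ : hbounded (fun n => app Q (u n)).
  by apply: (@hbounded_of_sqr _ 1 M) => // n; rewrite mul1r -q2.
have bQv : hbounded (fun n => app Q (v n)).
  by apply: (@hbounded_of_sqr _ 1 M') => // n; rewrite mul1r -q2.
have bu : hbounded u.
  by apply: (@hbounded_of_sqr _ c M) => // n; apply: le_trans (cA _ (Du n)) _.
(* Boundedness allows testing only on the dense [dom Q], where [Q] moves to the other side. *)
have wQ : wnull (fun n => app Q (u n)).
  apply: (wnull_dense sQ.2.1 bQ) => y Dy; apply: rnull_le (wu (app Q y)) => n.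
  by rewrite selfadjoint_ip //; exact: DQ.
have := rel_compact_wnull lQ lR cR (fun n => DQ _ (Du n)) bu bQ wu wQ.
have [K hK] := bQv; move=> h.
apply: rnull_le (rnull_bounded_mul h (g := fun n => hnorm (app Q (v n))) (M := K) _) => n.
  have [DR <-] := RQ _ (DQ _ (Du n)); rewrite selfadjoint_ip //; last exact: DQ.
  apply: le_trans (cauchy_schwarz _ _) (ler_norm _).
by rewrite ger0_norm ?hnorm_ge0.
Qed.
End SquareRoot.

(** * Coercive selfadjoint operators *)

Section Surjectivity.
Variables (R : realType) (H : Hilbert R).
Implicit Types (A : op H).

Lemma selfadjoint_ip_max A y z : selfadjoint A ->
  (forall v, dom A v -> ip (app A v) y = ip v z) -> dom A y /\ app A y = z.
Proof.
move=> [lA [_ [_ mA]]] h; apply: mA => v Dv; apply: inner_ext; first exact: h.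
have := h _ (domZ 'i%C lA Dv); rewrite (linear_on_iscale (dom0 lA) (linop_linear_on lA)) //.
by rewrite !ip_iscalel !ip_iscaler => /oppr_inj.
Qed.

Lemma rnull_sqr (f : nat -> R) : rnull (fun n => f n ^+ 2) -> rnull f.
Proof.
move=> h e e0; have e2 : 0 < e ^+ 2 by rewrite exprn_gt0.
apply: eventually_mono (h _ e2) => n.
by rewrite normrX ltr_pXn2r // nnegrE ?normr_ge0 // ltW.
Qed.

Lemma rnull_cst (a : R) : rnull (fun=> a) -> a = 0.
Proof.
move=> h; apply: NNPP => /eqP; rewrite -normr_gt0 => a0.
by have [n] := eventually_ex (h _ a0); rewrite ltxx.
Qed.

(* A minimising sequence of [<A x, x> - 2 Re <f, x>] is Cauchy, and its limit [l] satisfies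
   [<A v, l> = <v, f>] on [dom A], so that [A l = f] as [A] is selfadjoint. *)
Lemma coercive_surj A (c : R) : selfadjoint A -> coercive A c ->
  forall f, exists x, dom A x /\ app A x = f.
Proof.
move=> sA [c0 cA] f; have lA := sA.1; have lin := linop_linear_on lA.
pose Phi x := ip (app A x) x - 2 * ip f x.
pose E : R -> Prop := fun r => exists x, dom A x /\ r = Phi x.
have lbE : forall r, E r -> - (hnorm f ^+ 2 / c) <= r.
  move=> _ [x [Dx ->]]; rewrite /Phi; have := cA x Dx; have := ip_le f x.
  (* Completing the square: [c r^2 - 2 |f| r = c (r - |f| / c)^2 - |f|^2 / c] with [r = |x|]. *)
  have e : hnorm f ^+ 2 / c = c * (hnorm f / c) ^+ 2 by field; exact: lt0r_neq0.
  have := mulr_ge0 (ltW c0) (sqr_ge0 (hnorm x - hnorm f / c)).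
  have e2 : c * (hnorm f / c * hnorm x) = hnorm f * hnorm x by field; exact: lt0r_neq0.
  rewrite e sqrrB mulrDr mulrBr mulrnAr (mulrC (hnorm x)) e2; lra.
have infE : classical_sets.has_inf E.
  split; first by exists (Phi 0); exists 0; split => //; exact: dom0.
  by exists (- (hnorm f ^+ 2 / c)) => r /lbE.
have mP x : dom A x -> inf E <= Phi x.
  by move=> Dx; apply: ge_inf; [exact: infE.2 | exists x].
have : forall n : nat, exists x, dom A x /\ Phi x < inf E + n.+1%:R^-1.
  move=> n; have n0 : 0 < n.+1%:R^-1 :> R by rewrite invr_gt0 ltr0n.
  by have [_ [x [Dx ->]] h] := inf_adherent n0 infE; exists x.
move: (inf E) mP => m mP /choice_nat[x hx].
have Dx n : dom A (x n) := (hx n).1.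
(* Parallelogram identity: with [z] the midpoint of [x n] and [x p], the form of [x n - x p] equals
   [2 Phi (x n) + 2 Phi (x p) - 4 Phi z], and [m <= Phi z]. *)
have est n p : c * hnorm (x n - x p) ^+ 2 <= 2 * n.+1%:R^-1 + 2 * p.+1%:R^-1.
  apply: le_trans (cA _ (domB lA (Dx n) (Dx p))) _.
  have := mP _ (domZ (2^-1)%:C%C lA (domD lA (Dx n) (Dx p))).
  have := (hx n).2; have := (hx p).2; rewrite /Phi -/(rscale _ _).
  rewrite (linear_onB lin) // (linear_on_rscale (dom0 lA) lin) ?(linear_onD lin) //;
    last exact: domD.
  rewrite ipZl !ipZr !(ipDl, ipDr, ipNl, ipNr).
  rewrite (selfadjoint_ip sA (Dx p) (Dx n)) (ipC (x p)).
  by move: (n.+1%:R^-1) (p.+1%:R^-1) => a b; lra.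
have [|l hl] := @h_complete _ H x.
  move=> e e0; have d0 : 0 < c * e ^+ 2 / 4 by rewrite divr_gt0 // mulr_gt0 // exprn_gt0.
  have [N hN] := rnull_harmonic d0; exists N => n p Nn Np.
  move: (hN _ Nn) (hN _ Np) (est n p); rewrite !ger0_norm ?invr_ge0 ?ler0n // => h1 h2 h3.
  rewrite -(@ltr_pXn2r _ 2) ?nnegrE ?hnorm_ge0 ?(ltW e0) // -(ltr_pM2l c0).
  by move: (n.+1%:R^-1) (p.+1%:R^-1) h1 h2 h3 => a b; lra.
exists l; apply: selfadjoint_ip_max => // v Dv.
apply/eqP; rewrite -subr_eq0; apply/eqP; apply: rnull_cst.
have n1 : rnull (fun n => ip (app A (x n)) v - ip f v).
  apply: rnull_sqr; apply: rnull_le (rnullZ (ip (app A v) v) (@rnull_harmonic R)) => n.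
  rewrite ger0_norm ?sqr_ge0 //; apply: le_trans (ler_norm _).
  have q0 : 0 <= ip (app A v) v.
    by apply: le_trans (cA _ Dv); rewrite mulr_ge0 ?sqr_ge0 // ltW.
  apply: (@le_trans _ _ ((Phi (x n) - m) * ip (app A v) v)).
    (* As [m] is a lower bound, [Phi (x n + t v) - m] is a quadratic in [t] that is never negative;
       its discriminant controls [<A x_n - f, v>]. *)
    apply: discriminant_le => // t.
    have := mP _ (domD lA (Dx n) (domZ t%:C%C lA Dv)); rewrite -/(rscale _ _) /Phi.
    rewrite (linear_onD lin) ?(linear_on_rscale (dom0 lA) lin) //; last exact: domZ.
    rewrite !(ipDl, ipDr, ipZl, ipZr) (selfadjoint_ip sA Dv (Dx n)) (ipC v) -subr_ge0.
    by congr (_ <= _); ring.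
  by rewrite mulrC ler_wpM2l // lerBlDl ltW //; exact: (hx n).2.
have n2 : rnull (fun n => ip (app A v) (x n - l)).
  apply: rnull_le (rnullZ (hnorm (app A v)) (f := fun n => hnorm (x n - l)) _) => [n|].
    by rewrite [leRHS]ger0_norm ?mulr_ge0 ?hnorm_ge0 // cauchy_schwarz.
  by move=> e /hl[N hN]; exists N => n /hN; rewrite ger0_norm ?hnorm_ge0.
apply: rnull_le (rnullB n1 n2) => n.
rewrite ipBr (selfadjoint_ip sA (Dx n) Dv) (ipC (x n)) (ipC f).
by rewrite le_eqVlt; apply/orP; left; apply/eqP; congr `|_|; ring.
Qed.
End Surjectivity.

(** * The uniform boundedness principle *)

Section UniformBoundedness.
Variables (R : realType) (H : Hilbert R).

(* Gliding hump: were the [h_k] too large, adding [+- 3^-k h_k / |h_k|] one after the other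
   would produce a vector [y] with [|<y, h_k>| >= 3^-k |h_k| / 2]. *)
Lemma uniform_boundedness (g : nat -> H) :
  (forall y, exists M : R, forall n, `|ip y (g n)| <= M) ->
  exists M : R, forall n, hnorm (g n) <= M.
Proof.
move=> hg; apply: NNPP => nb.
(* With ratio [1/3] the steps after the [k]-th add up to at most [3/2 t (k+1) = t k / 2], so they
   spoil at most half of the [t k |h k|] secured at step [k]. *)
pose t (k : nat) : R := (3^-1) ^+ k.
have t0 k : 0 < t k by rewrite /t exprn_gt0 // invr_gt0.
have tS k : t k.+1 = t k / 3 by rewrite /t exprSr.
have tle k : t k <= k.+1%:R^-1.
  by rewrite /t exprVn lef_pV2 ?posrE ?exprn_gt0 // -natrX ler_nat ltn_expl.
have : forall k : nat, exists n, k.+1%:R / t k < hnorm (g n).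
  move=> k; apply: NNPP => hk; apply: nb; exists (k.+1%:R / t k) => n.
  by rewrite leNgt; apply/negP => ?; apply: hk; exists n.
move=> /choice_nat[nu hnu]; pose h k := g (nu k).
have h0 k : 0 < hnorm (h k).
  by apply: le_lt_trans (hnu k); rewrite divr_ge0 // ltW.
(* The sign agrees with that of [<y, h k>], so the new term cannot cancel the old one. *)
pose step k y := y + ((if 0 <= ip y (h k) then 1 else -1) * (t k / hnorm (h k))) *r h k.
pose y := fix y k := if k is k'.+1 then step k' (y k') else 0.
have ystep k : hnorm (y k.+1 - y k) <= t k.
  rewrite /= /step addrC addKr hnormZ normrM.
  have -> : `|if 0 <= ip (y k) (h k) then 1 else -1 : R| = 1.
    by case: ifP; rewrite ?normrN normr1.
  by rewrite mul1r ger0_norm ?divr_ge0 ?(ltW (t0 k)) ?(ltW (h0 k)) // divfK // lt0r_neq0.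
have ylarge k : t k * hnorm (h k) <= `|ip (y k.+1) (h k)|.
  rewrite /= /step ipDl ipZl -hnorm_sqr.
  have th : t k / hnorm (h k) * hnorm (h k) ^+ 2 = t k * hnorm (h k).
    by field; exact: lt0r_neq0.
  rewrite -mulrA th; have := mulr_gt0 (t0 k) (h0 k).
  case: ifP => [p|/negbT]; rewrite ?mul1r ?mulN1r; last rewrite -ltNge => n0; move=> ?.
    by rewrite ger0_norm ?addr_ge0 ?mulr_ge0 ?(ltW (t0 k)) ?hnorm_ge0 // lerDr.
  by rewrite ltr0_norm; lra.
have ydist n p : hnorm (y (n + p)%N - y n) <= 3 / 2 * (t n - t (n + p)%N).
  elim: p => [|p IH]; first by rewrite addn0 !subrr hnorm0 mulr0.
  rewrite addnS; apply: le_trans (ler_hnorm_dist _ (y (n + p)%N) _) _.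
  by have := ystep (n + p)%N; rewrite tS; lra.
have ydist2 N n : (N <= n)%N -> hnorm (y n - y N) <= 3 / 2 * t N.
  move=> /subnKC <-; apply: le_trans (ydist _ _) _.
  by have := t0 (N + (n - N))%N; lra.
have [|l hl] := @h_complete _ H y.
  move=> e e0; have e3 : 0 < e / 3 by rewrite divr_gt0.
  have [N hN] := rnull_harmonic e3; exists N => n m Nn Nm.
  have := hN N (leqnn N); rewrite ger0_norm ?invr_ge0 ?ler0n // => hN2.
  have := ler_hnorm_dist (y n) (y N) (y m); rewrite (hnorm_distC (y N)).
  by have := ydist2 _ _ Nn; have := ydist2 _ _ Nm; have := le_lt_trans (tle N) hN2; lra.
have ldist n : hnorm (l - y n) <= 3 / 2 * t n.
  apply/ler_addgt0Pr => e e0.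
  have [m [nm hm]] := eventually_ex (eventually_and (eventually_ge n) (hl e e0)).
  have := ler_hnorm_dist l (y m) (y n); rewrite (hnorm_distC l (y m)).
  by have := ydist2 _ _ nm; lra.
have [M hM] := hg l.
have [k hk] := exists_natr_gt (2 * M).
have h1 : `|ip (y k.+1 - l) (h k)| <= t k / 2 * hnorm (h k).
  apply: le_trans (cauchy_schwarz _ _) _; rewrite hnorm_distC ler_wpM2r ?hnorm_ge0 //.
  by have := ldist k.+1; rewrite tS; lra.
have h2 : k.+1%:R < hnorm (h k) * t k by rewrite -ltr_pdivrMr.
have := ler_normD (ip (y k.+1 - l) (h k)) (ip l (h k)); rewrite -ipDl subrK.
have := hM (nu k); rewrite -/(h k); have := ylarge k; rewrite -natr1 in h2; lra.
Qed.
End UniformBoundedness.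

(** * Interpolation in the form norm *)

Section Interpolation.
Variable R : realType.

Lemma bernoulli_le (d : R) (n : nat) : 0 <= d -> 1 + n%:R * d <= (1 + d) ^+ n.
Proof.
move=> d0; elim: n => [|n IH]; first by rewrite mul0r addr0 expr0.
rewrite exprS -natr1; have n0 : 0 <= n%:R :> R by rewrite ler0n.
have d1 : 0 <= 1 + d by lra.
apply: le_trans (ler_wpM2l d1 IH); nra.
Qed.

(** Log-convexity makes the ratios [p (n+1) / p n] nondecreasing; a first ratio [r > k] would force
    [p n >= r^n p 0], which outgrows [k^n D]. *)
Lemma log_convex_growth (p : nat -> R) (k D : R) : 0 <= k -> (forall n, 0 <= p n) ->
  (forall n, p n.+1 ^+ 2 <= p n * p n.+2) -> (forall n, p n <= k ^+ n * D) ->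
  p 1%N <= k * p 0%N.
Proof.
move=> k0 p0 lc pD; rewrite leNgt; apply/negP => h.
have p00 : 0 < p 0%N.
  rewrite lt_def p0 andbT; apply/negP => /eqP e; have := lc 0%N.
  by move: h; rewrite e mulr0 mul0r => h; rewrite leNgt exprn_gt0.
have [r rE] : exists r, r = p 1%N / p 0%N by exists (p 1%N / p 0%N).
have rp : p 1%N = r * p 0%N by rewrite rE divfK // lt0r_neq0.
have kr : k < r by rewrite rE ltr_pdivlMr.
have r0 : 0 < r := le_lt_trans k0 kr.
have grow n : 0 < p n /\ r * p n <= p n.+1.
  elim: n => [|n [pn h1]]; first by rewrite rp.
  have pn1 : 0 < p n.+1 by apply: lt_le_trans h1; rewrite mulr_gt0.
  split=> //; rewrite -(ler_pM2l pn); have := lc n; nra.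
have geo n : r ^+ n * p 0%N <= p n.
  elim: n => [|n IH]; first by rewrite expr0 mul1r.
  by apply: le_trans (grow n).2; rewrite exprS -mulrA ler_pM2l.
have [kz|kn] := eqVneq k 0.
  by have := pD 1%N; rewrite kz expr1 mul0r leNgt (grow 1%N).1.
have kp : 0 < k by rewrite lt_def kn.
have d0 : 0 < r / k - 1 by rewrite subr_gt0 ltr_pdivlMr // mul1r.
suff : (r / k - 1) * p 0%N <= 0 by rewrite leNgt mulr_gt0.
(* Since [(r / k)^n p 0 <= D], Bernoulli's inequality gives [n (r / k - 1) p 0 <= D] for every
   [n]. *)
apply: (@natr_le_unbounded _ _ D) => n.
have h1 : (r / k) ^+ n * p 0%N <= D.
  by rewrite exprMn exprVn mulrAC ler_pdivrMr ?exprn_gt0 // (le_trans (geo n)) // mulrC.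
have := bernoulli_le n (ltW d0); have -> : 1 + (r / k - 1) = r / k by ring.
by move=> /(ler_wpM2r (ltW p00)); lra.
Qed.

Variable H : Hilbert R.
Implicit Types (A : op H) (x y : H).

Lemma coercive_inv A c : selfadjoint A -> coercive A c ->
  exists V : H -> H, forall f, dom A (V f) /\ app A (V f) = f.
Proof.
move=> sA cA; have h := coercive_surj sA cA.
exists (fun f => epsilon (inhabits (0 : H)) (fun x => dom A x /\ app A x = f)) => f.
exact: (epsilon_spec (inhabits (0 : H)) _ (h f)).
Qed.

Section Coercive.
Variables (A : op H) (c : R).
Hypotheses (sA : selfadjoint A) (cA : coercive A c).

Lemma form_ge0 x : dom A x -> 0 <= ip (app A x) x.
Proof.
by case: cA => c0 h /h; apply: le_trans; rewrite mulr_ge0 ?sqr_ge0 // ltW.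
Qed.

Lemma coercive_norm_le x : dom A x -> c * hnorm x <= hnorm (app A x).
Proof.
move=> Dx; have [c0 h] := cA; rewrite leNgt; apply/negP => h1.
have x0 : 0 < hnorm x.
  rewrite lt_def hnorm_ge0 andbT; apply/negP => /eqP e; move: h1.
  by rewrite e mulr0 ltNge hnorm_ge0.
have := h _ Dx; have := ip_le (app A x) x; nra.
Qed.

Lemma form_le_norm x : dom A x -> ip (app A x) x <= hnorm (app A x) ^+ 2 / c.
Proof.
move=> Dx; have [c0 _] := cA; rewrite ler_pdivlMr //.
by have := ip_le (app A x) x; have := coercive_norm_le Dx;
   have := hnorm_ge0 (app A x); nra.
Qed.

(** The discriminant of [<A (x + t y), x + t y> >= 0] in [t]: Cauchy-Schwarz for the form inner
    product. *)
Lemma form_sqr_le x y : dom A x -> dom A y ->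
  ip (app A x) y ^+ 2 <= ip (app A x) x * ip (app A y) y.
Proof.
move=> Dx Dy; have lA := sA.1; have lin := linop_linear_on lA.
apply: discriminant_le => [|t]; first exact: form_ge0.
have := form_ge0 (domD lA Dx (domZ t%:C%C lA Dy)); rewrite -/(rscale _ _).
rewrite (linear_onD lin) ?(linear_on_rscale (dom0 lA) lin) //; last exact: domZ.
rewrite !(ipDl, ipDr, ipZl, ipZr) (selfadjoint_ip sA Dy Dx) (ipC y).
by congr (_ <= _); ring.
Qed.

(* With [K = A^-1 F] and [P = A^-1 G A^-1 F], both viewed in the form inner product
   [<A x, y>], [P = K^* K] is symmetric and [|A P^n x| <= (a b)^n |A x|]; log-convexity of
   [<A P^n x, P^n x>] turns this into a bound of [P] in the form norm. *)
Lemma form_interpolation (F G : H -> H) (a b : R) : 0 <= a -> 0 <= b ->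
  (forall x, dom A x -> hnorm (F x) <= a * hnorm (app A x)) ->
  (forall x, dom A x -> hnorm (G x) <= b * hnorm (app A x)) ->
  (forall x y, dom A x -> dom A y -> ip (F x) y = ip x (G y)) ->
  forall x y, dom A x -> dom A y ->
    ip (F x) y ^+ 2 <= a * b * (ip (app A x) x * ip (app A y) y).
Proof.
move=> a0 b0 Fa Gb FG x y Dx Dy; have [c0 _] := cA.
have [V hV] := coercive_inv sA cA.
have DV f : dom A (V f) := (hV f).1.
have AV f : app A (V f) = f := (hV f).2.
pose K z := V (F z); pose P z := V (G (K z)).
have PK z w : dom A w -> ip (app A (P z)) w = ip (app A (K z)) (K w).
  move=> Dw; have Dz : dom A (K z) := DV _; have Dw' : dom A (K w) := DV _.
  by rewrite /P AV ipC -FG // ipC (selfadjoint_ip sA Dz Dw') /K AV.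
have Psym z w : dom A z -> dom A w -> ip (app A (P z)) w = ip (app A (P w)) z.
  by move=> Dz Dw; rewrite !PK // ipC (selfadjoint_ip sA) //; exact: DV.
have DP n : dom A (iter n P x) by case: n => //= n; exact: DV.
pose p n := ip (app A (iter n P x)) (iter n P x).
(* One application of [P] costs [a b]: [|A P z| = |G K z| <= b |A K z| = b |F z| <= a b |A z|]. *)
have nP n : hnorm (app A (iter n P x)) <= (a * b) ^+ n * hnorm (app A x).
  elim: n => [|n IH]; first by rewrite mul1r.
  rewrite /= /P AV; apply: le_trans (Gb _ (DV _)) _; rewrite AV.
  apply: le_trans (ler_wpM2l b0 (Fa _ (DP n))) _.
  by rewrite exprS -!mulrA mulrCA ler_wpM2l // ler_wpM2l.
have p1 : p 1%N <= (a * b) ^+ 2 * p 0%N.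
  apply: (@log_convex_growth p _ (hnorm (app A x) ^+ 2 / c)) => [||n|n].
  - exact: sqr_ge0.
  - by move=> n; exact: form_ge0.
  (* Symmetry of [P] rewrites [p (n+1)] as [<A P^(n+2) x, P^n x>], to which Cauchy-Schwarz
     applies. *)
  - rewrite mulrC; apply: le_trans (form_sqr_le (DP n.+2) (DP n)).
    by rewrite /p -(Psym _ _ (DP n) (DP n.+1)).
  - apply: le_trans (form_le_norm (DP n)) _.
    rewrite mulrA ler_pM2r ?invr_gt0 // -exprM mulnC exprM -exprMn.
    by rewrite lerXn2r ?nnegrE ?hnorm_ge0 ?mulr_ge0 ?exprn_ge0 ?hnorm_ge0 ?mulr_ge0.
have qx0 : 0 <= p 0%N by exact: form_ge0.
(* [<A K x, K x> = <A P x, x>] is at most [sqrt (p 1 * p 0) <= a b p 0]. *)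
have KP : ip (app A (K x)) (K x) <= a * b * p 0%N.
  rewrite -PK // -(@ler_pXn2r _ 2) ?nnegrE ?mulr_ge0 //; last first.
    by rewrite PK // form_ge0 //; exact: DV.
  apply: le_trans (form_sqr_le (DP 1%N) Dx) _.
  by have := ler_wpM2r qx0 p1; rewrite exprMn /p /=; nra.
have -> : F x = app A (K x) by rewrite /K AV.
apply: le_trans (form_sqr_le (DV _) Dy) _; rewrite mulrA ler_wpM2r //.
exact: form_ge0.
Qed.

(** As [<A^-1 S v, y> = <v, S^* A^-1 y>] is bounded by [|v|] times a constant depending on [y],
    uniform boundedness makes [A^-1 S] bounded; then [<v, S^* y> = <A^-1 S v, A y>], tested on the
    dense [dom A], bounds [S^* y]. *)
Lemma adjoint_bound (S : op H) : linop S -> (forall x, dom A x -> dom S x /\ adj_dom S x) ->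
  exists2 b : R, 0 <= b & forall y z, dom A y ->
    (forall x, dom S x -> ip (app S x) y = ip x z) -> hnorm z <= b * hnorm (app A y).
Proof.
move=> lS AS; have [c0 _] := cA; have [V hV] := coercive_inv sA cA.
have DV f : dom A (V f) := (hV f).1.
have AV f : app A (V f) = f := (hV f).2.
have V0 : V 0 = 0.
  apply: hnorm_eq0; have := coercive_norm_le (DV 0); rewrite AV hnorm0.
  by have := hnorm_ge0 (V 0); nra.
have [b b0 hb] : exists2 b : R, 0 <= b &
    forall v, dom S v -> hnorm (V (app S v)) <= b * hnorm v.
  apply: NNPP => nb.
  have : forall n : nat, exists v, dom S v /\ n%:R * hnorm v < hnorm (V (app S v)).
    move=> n; apply: NNPP => hn; apply: nb; exists n%:R; rewrite ?ler0n // => v Dv.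
    by rewrite leNgt; apply/negP => ?; apply: hn; exists v.
  move=> /choice_nat[v hv].
  have v0 n : 0 < hnorm (v n).
    rewrite lt_def hnorm_ge0 andbT; apply/negP => /eqP e; have := (hv n).2.
    by rewrite e mulr0 (hnorm_eq0 e) (linear_on0 (dom0 lS) (linop_linear_on lS)) V0 hnorm0 ltxx.
  have [M hM] : exists M : R, forall n, hnorm ((hnorm (v n))^-1 *r V (app S (v n))) <= M.
    apply: uniform_boundedness => y.
    have [z hz] := (AS _ (DV y)).2; exists (hnorm z) => n.
    rewrite ipZr -{1}(AV y) (selfadjoint_ip sA) // AV ipC {1}/ip hz; last exact: (hv n).1.
    rewrite normrM ger0_norm ?invr_ge0 ?hnorm_ge0 // ler_pdivrMl //.
    exact: cauchy_schwarz.
  have [n hn] := exists_natr_gt M.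
  have := hM n; rewrite hnormZ ger0_norm ?invr_ge0 ?hnorm_ge0 // ler_pdivrMl //.
  by have := (hv n).2; have := v0 n; nra.
exists b => // y z Dy h; apply: (dense_hnorm_le sA.2.1).
  by rewrite mulr_ge0 // hnorm_ge0.
move=> v Dv; have DSv := (AS _ Dv).1; rewrite -h // -(AV (app S v)) (selfadjoint_ip sA) //.
apply: le_trans (ip_le _ _) _.
by have := hb _ DSv; have := hnorm_ge0 (app A y); nra.
Qed.
End Coercive.
End Interpolation.

Lemma subrACA (V : zmodType) (a b c d : V) : a - b - (c - d) = a - c - (b - d).
Proof. by rewrite !opprD !opprK addrACA. Qed.

(** * Resolvents and relatively compact perturbations *)

Section Resolvent.
Variables (R : realType) (H : Hilbert R) (A : op H) (c : R).
Hypotheses (sA : selfadjoint A) (cA : coercive A c).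
Implicit Types (e : R) (J : H -> H) (f x y : H).

(** [J] is [(1 + e A)^-1], specified as a right inverse; that it is also a left inverse is
    [resolvent_uniq]. *)
Definition is_resolvent e J : Prop :=
  0 < e /\ forall f, dom A (J f) /\ J f + e *r app A (J f) = f.

(** The operator [1 + e A] on [dom A] is selfadjoint and coercive with constant [1], hence onto. *)
Lemma resolvent_exists e : 0 < e -> exists J, is_resolvent e J.
Proof.
move=> e0; have lA := sA.1; have lin := linop_linear_on lA.
pose T : op H := mkop (dom A) (fun x => x + e *r app A x).
have lT : linop T.
  split=> [|a x y Dx Dy]; first exact: (dom0 lA).
  split; first exact: domZD lA Dx Dy.
  by rewrite /= lin // /rscale !scalerDr !scalerA (mulrC _ a) addrACA.
have symT x y : dom A x -> dom A y -> ip (app T x) y = ip x (app T y).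
  by move=> Dx Dy; rewrite !(ipDl, ipDr, ipZl, ipZr) (selfadjoint_ip sA).
have sT : selfadjoint T.
  split=> //; split; [exact: sA.2.1|split].
  - move=> x y Dx Dy; apply: inner_ext; first exact: symT.
    rewrite symT //; last exact: domZ.
    by rewrite (linear_on_iscale (dom0 lT) (linop_linear_on lT)).
  - move=> y z h; have [|DA yz] := @selfadjoint_ip_max _ _ A y (e^-1 *r (z - y)) sA.
      move=> v Dv; have : ip (v + e *r app A v) y = ip v z by rewrite /ip h.
      rewrite ipDl !ipZl ipZr ipBr => <-; field; exact: lt0r_neq0.
    split=> //=; rewrite yz rscaleA mulfV ?rscale1 ?lt0r_neq0 //.
    by rewrite addrC subrK.
have cT : coercive T 1.
  split=> // x Dx; rewrite mul1r /= ipDl ipZl -hnorm_sqr lerDl mulr_ge0 ?(ltW e0) //.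
  exact: form_ge0 cA _ Dx.
by have [J hJ] := coercive_inv sT cT; exists J.
Qed.

Section Properties.
Variables (e : R) (J : H -> H).
Hypothesis hJ : is_resolvent e J.
Let e0 : 0 < e := hJ.1.

Lemma resolvent_dom f : dom A (J f).
Proof. exact: (hJ.2 f).1. Qed.
Lemma resolventE f : J f + e *r app A (J f) = f.
Proof. exact: (hJ.2 f).2. Qed.
Lemma sub_resolvent f : f - J f = e *r app A (J f).
Proof. by rewrite -{1}(resolventE f) addrC addKr. Qed.
Lemma app_resolvent f : app A (J f) = e^-1 *r (f - J f).
Proof. by rewrite sub_resolvent rscaleA mulVf ?rscale1 // lt0r_neq0. Qed.

(** Expansion along [f = J f + e A J f]; all terms are nonnegative, so both [J] and [1 - J] are
    contractions. *)
Lemma resolvent_norms f : ip f f = hnorm (J f) ^+ 2 +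
  2 * e * ip (app A (J f)) (J f) + hnorm (f - J f) ^+ 2.
Proof.
rewrite !hnorm_sqr sub_resolvent -{1 2}(resolventE f) !(ipDl, ipDr, ipZl, ipZr).
by rewrite (ipC (J f) (app A _)); ring.
Qed.
Lemma hnorm_resolvent f : hnorm (J f) <= hnorm f.
Proof.
rewrite hnorm_le ?hnorm_ge0 // -!hnorm_sqr hnorm_sqr -hnorm_sqr (hnorm_sqr f) resolvent_norms.
have := mulr_ge0 (ltW e0) (form_ge0 cA (resolvent_dom f)).
by have := sqr_ge0 (hnorm (f - J f)); lra.
Qed.
Lemma hnorm_sub_resolvent f : hnorm (f - J f) <= hnorm f.
Proof.
rewrite hnorm_le ?hnorm_ge0 // -!hnorm_sqr hnorm_sqr -hnorm_sqr (hnorm_sqr f) resolvent_norms.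
have := mulr_ge0 (ltW e0) (form_ge0 cA (resolvent_dom f)).
by have := sqr_ge0 (hnorm (J f)); lra.
Qed.

(** The difference [w] of two solutions satisfies [w + e A w = 0]; pairing with [w] leaves two
    nonnegative terms with sum zero. *)
Lemma resolvent_uniq x f : dom A x -> x + e *r app A x = f -> J f = x.
Proof.
move=> Dx xf; have lA := sA.1.
have D := domB lA (resolvent_dom f) Dx.
have h : (J f - x) + e *r app A (J f - x) = 0.
  rewrite (linear_onB (linop_linear_on lA)) //; last exact: resolvent_dom.
  by rewrite rscaleDr rscaleNr addrACA resolventE -opprD xf subrr.
apply/eqP; rewrite -subr_eq0; apply/eqP; apply: ip_eq0.
have := ip0l (J f - x); rewrite -{1}h ipDl ipZl.
have := mulr_ge0 (ltW e0) (form_ge0 cA D); have := ip_ge0 (J f - x); lra.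
Qed.
Lemma resolventB x y : J (x - y) = J x - J y.
Proof.
apply: resolvent_uniq; first exact: domB sA.1 (resolvent_dom x) (resolvent_dom y).
rewrite (linear_onB (linop_linear_on sA.1)) ?rscaleDr ?rscaleNr; try exact: resolvent_dom.
by rewrite addrACA resolventE -opprD resolventE.
Qed.
Lemma resolvent0 : J 0 = 0.
Proof. by have := resolventB 0 0; rewrite !subrr. Qed.
Lemma resolventZ (a : R) x : J (a *r x) = a *r J x.
Proof.
have lA := sA.1; apply: resolvent_uniq; first by apply: domZ => //; exact: resolvent_dom.
rewrite (linear_on_rscale (dom0 lA) (linop_linear_on lA)); last exact: resolvent_dom.
by rewrite rscaleA mulrC -rscaleA -rscaleDr resolventE.
Qed.
Lemma resolvent_sym x y : ip (J x) y = ip x (J y).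
Proof.
rewrite -{1}(resolventE y) -{2}(resolventE x) !(ipDl, ipDr, ipZl, ipZr).
by rewrite (selfadjoint_ip sA) //; exact: resolvent_dom.
Qed.
Lemma resolvent_comm f : dom A f -> app A (J f) = J (app A f).
Proof.
move=> Df; have lA := sA.1; have lin := linop_linear_on lA.
have DJ := resolvent_dom f; have Dd := domB lA Df DJ.
apply/esym/resolvent_uniq.
  by rewrite app_resolvent; exact: domZ.
rewrite {2}app_resolvent (linear_on_rscale (dom0 lA) lin) // (linear_onB lin) //.
by rewrite rscaleA mulfV ?lt0r_neq0 // rscale1 addrC subrK.
Qed.
Lemma hnorm_sub_resolvent_le f : dom A f -> hnorm (f - J f) <= e * hnorm (app A f).
Proof.
move=> Df; rewrite sub_resolvent resolvent_comm // hnormZ gtr0_norm // ler_pM2l //.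
exact: hnorm_resolvent.
Qed.
(** The left side is [e (<A J f, f> - <A J f, J f>)]; with [s], [t] the form norms of [J f], [f],
    the bracket is at most [s t - s^2 <= t^2]. *)
Lemma hnorm_sub_resolvent_form f : dom A f ->
  hnorm (f - J f) ^+ 2 <= e * ip (app A f) f.
Proof.
move=> Df; rewrite hnorm_sqr {1}sub_resolvent ipZl ler_pM2l // ipBr.
have := form_sqr_le sA cA (resolvent_dom f) Df.
have := form_ge0 cA (resolvent_dom f); have := form_ge0 cA Df; nra.
Qed.
Lemma hnorm_app_resolvent f : hnorm (app A (J f)) <= e^-1 * hnorm f.
Proof.
rewrite app_resolvent hnormZ gtr0_norm ?invr_gt0 // ler_pM2l ?invr_gt0 //.
exact: hnorm_sub_resolvent.
Qed.
End Properties.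

(** On [dom A] the rate is [|A y| / (n + 1)]; density extends the convergence to all [f], as each
    [1 - J n] is a contraction. *)
Lemma resolvent_cvg (J : nat -> H -> H) f :
  (forall n, is_resolvent n.+1%:R^-1 (J n)) -> rnull (fun n => hnorm (f - J n f)).
Proof.
move=> hJ; apply: rnull_approx => d d0.
have [y [Dy hy]] := sA.2.1 f _ d0.
exists (fun n => hnorm (y - J n y)).
  apply: rnull_le (rnullZ (hnorm (app A y)) (@rnull_harmonic R)) => n.
  rewrite !ger0_norm ?mulr_ge0 ?hnorm_ge0 ?invr_ge0 ?ler0n // mulrC.
  exact: hnorm_sub_resolvent_le (hJ n) _ Dy.
move=> n; apply: le_trans (ltW hy); apply: le_trans (hnorm_sub_resolvent (hJ n) (f - y)).
have -> : f - y - J n (f - y) = (f - J n f) - (y - J n y) by rewrite (resolventB (hJ n)) subrACA.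
exact: ler_dist_hnorm.
Qed.

(* [S A^-1] is compact and [1 - J_n -> 0] strongly, so [(1 - J_n) S A^-1 -> 0] in norm. *)
Lemma rel_compact_resolvent (S : op H) (J : nat -> H -> H) (d : R) :
  (forall n, is_resolvent n.+1%:R^-1 (J n)) -> linear_on (dom A) (app S) ->
  rel_compact A S -> 0 < d ->
  exists n, forall x, dom A x -> hnorm (app S x - J n (app S x)) <= d * hnorm (app A x).
Proof.
move=> hJ lS [_ cS] d0; have [c0 _] := cA; have lA := sA.1; have lin := linop_linear_on lA.
apply: NNPP => nh.
have : forall n : nat, exists x, [/\ dom A x, hnorm (app A x) = 1 &
    d < hnorm (app S x - J n (app S x))].
  move=> n; apply: NNPP => hn; apply: nh; exists n => x Dx.
  rewrite leNgt; apply/negP => hx; apply: hn.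
  have A0 : 0 < hnorm (app A x).
    rewrite lt_def hnorm_ge0 andbT; apply/negP => /eqP e; move: hx; rewrite e mulr0.
    have -> : x = 0.
      apply: hnorm_eq0; have := coercive_norm_le cA Dx.
      by rewrite e; have := hnorm_ge0 x; nra.
    by rewrite (linear_on0 (dom0 lA) lS) (resolvent0 (hJ n)) subrr hnorm0 ltxx.
  exists ((hnorm (app A x))^-1 *r x); rewrite (linear_on_rscale (dom0 lA) lin) //.
  rewrite (linear_on_rscale (dom0 lA) lS) // (resolventZ (hJ n)) -rscaleNr -rscaleDr.
  rewrite !hnormZ gtr0_norm ?invr_gt0 // mulVf ?lt0r_neq0 //.
  split=> //; first exact: domZ.
  by rewrite ltr_pdivlMl // mulrC.
move=> /choice_nat[x hx].
have Dx n : dom A (x n) by case: (hx n).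
have [||phi [mphi [l hl]]] := cS x Dx.
- exists (1 / c) => n; have := coercive_norm_le cA (Dx n).
  by case: (hx n) => _ -> _; rewrite ler_pdivlMr // mulrC.
- by exists 1 => n; case: (hx n) => _ -> _.
have d2 : 0 < d / 2 by rewrite divr_gt0.
(* The resolvents run along the same subsequence as the vectors, and still converge strongly since
   [n <= phi n]. *)
have rl := rnull_sub (fun n => strictly_mono_ge n mphi) (resolvent_cvg l hJ).
have [n [h1 h2]] := eventually_ex (eventually_and (hl _ d2) (rl _ d2)).
have [_ _] := hx (phi n); move: (app S _) (hJ (phi n)) h1 h2 => s hJn h1.
rewrite ger0_norm ?hnorm_ge0 // => h2.
have := hnorm_sub_resolvent hJn (s - l); rewrite (resolventB hJn) => h3.
rewrite subrACA in h3.
have := ler_hnormD ((s - J (phi n) s) - (l - J (phi n) l)) (l - J (phi n) l).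
by rewrite subrK; lra.
Qed.

Lemma form_bounded_hbounded (u : nat -> H) : form_bounded A u -> hbounded u.
Proof.
move=> [Du [M hM]]; have [c0 h] := cA; apply: (@hbounded_of_sqr _ _ _ c M) => // n.
exact: le_trans (h _ (Du n)) (hM n).
Qed.

(* Up to errors controlled by [form_interpolation] and [hnorm_sub_resolvent_form],
   [<S u, v>] is [<S J' u, J v>] with resolvents [J] and [J'], and [S J'] is compact. *)
Lemma form_compact_rel_compact (S : op H) : linop S -> rel_compact A S ->
  (forall x, dom A x -> dom S x /\ adj_dom S x) -> form_compact A S.
Proof.
move=> lS cS AS u v bu bv wu; have [c0 _] := cA; have lA := sA.1.
have lSA : linear_on (dom A) (app S).
  by move=> a x y /AS[Dx _] /AS[Dy _]; apply: (linop_linear_on lS).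
have [B hB] := form_bounded_hbounded bv.
have [Bu hBu] := form_bounded_hbounded bu.
move: (bu) (bv) => [Du [M hM]] [Dv [M' hM']].
have M0 : 0 <= M := le_trans (form_ge0 cA (Du 0%N)) (hM 0%N).
have M'0 : 0 <= M' := le_trans (form_ge0 cA (Dv 0%N)) (hM' 0%N).
have B0 : 0 <= B := le_trans (hnorm_ge0 _) (hB 0%N).
have [a a0 ha] := rel_compact_bound lA lSA cS.
have [b b0 hb] := adjoint_bound sA cA lS AS.
have [Sa hSa] : exists Sa : H -> H, forall y, dom A y ->
    forall x, dom S x -> ip (app S x) y = ip x (Sa y).
  exists (fun y => epsilon (inhabits (0 : H)) (fun z =>
    forall x, dom S x -> inner (app S x) y = inner x z)) => y Dy x Dx.
  have h := epsilon_spec (inhabits (0 : H)) _ (AS _ Dy).2.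
  by rewrite /ip (h x Dx).
have hSab y : dom A y -> hnorm (Sa y) <= b * hnorm (app A y).
  by move=> Dy; apply: hb => //; exact: hSa.
have [J hJ] : exists J : nat -> H -> H, forall n, is_resolvent n.+1%:R^-1 (J n).
  by apply: (choice_nat (P := fun n J => is_resolvent n.+1%:R^-1 J)) => n;
    apply: resolvent_exists; rewrite invr_gt0 ltr0n.
apply: rnull_approx => e e0; have e2 : 0 < (e / 2) ^+ 2 by rewrite exprn_gt0 // divr_gt0.
have bMM : 0 <= b * M * M' by rewrite !mulr_ge0.
(* This value makes [d b M M' <= (e / 2)^2]; the [+ 1] keeps the denominator positive. *)
have d0 : 0 < (e / 2) ^+ 2 / (b * M * M' + 1) by rewrite divr_gt0 // ltr_wpDl.
have [n hn] := rel_compact_resolvent hJ lSA cS d0.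
(* [1 - J n] commutes with [A] and is a contraction, so the constant [b] does not depend on [n]. *)
have Gb y : dom A y -> hnorm (Sa (y - J n y)) <= b * hnorm (app A y).
  move=> Dy; have DJ := resolvent_dom (hJ n) y; apply: le_trans (hSab _ (domB lA Dy DJ)) _.
  rewrite (linear_onB (linop_linear_on lA)) // (resolvent_comm (hJ n)) //.
  by rewrite ler_wpM2l // (hnorm_sub_resolvent (hJ n)).
have FG x y : dom A x -> dom A y ->
    ip (app S x - J n (app S x)) y = ip x (Sa (y - J n y)).
  move=> Dx Dy; rewrite ipBl (resolvent_sym (hJ n)) -ipBr hSa //; last exact: (AS _ Dx).1.
  exact: domB lA Dy (resolvent_dom (hJ n) y).
have tail k : `|ip (app S (u k)) (v k) - ip (app S (u k)) (J n (v k))| <= e / 2.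
  rewrite -(@ler_pXn2r _ 2) ?nnegrE ?divr_ge0 ?(ltW e0) // real_normK ?num_real //.
  have := form_interpolation sA cA (ltW d0) b0 hn Gb FG (Du k) (Dv k).
  rewrite ipBl (resolvent_sym (hJ n)) => h; apply: le_trans h _.
  have hMM : ip (app A (u k)) (u k) * ip (app A (v k)) (v k) <= M * M'.
    by apply: ler_pM => //; exact: form_ge0 cA _ _.
  apply: (@le_trans _ _ ((e / 2) ^+ 2 / (b * M * M' + 1) * b * (M * M'))).
    by rewrite ler_wpM2l // mulr_ge0 // ltW.
  rewrite -mulrA mulrAC ler_pdivrMr ?ltr_wpDl // ler_pM2l //; lra.
(* [L] bounds [|S^* J_n v_k|], as [|A J_n v| <= (n + 1) |v|]. It depends on [n], so [J'] is chosen
   only after [J n], with a parameter [e'] such that [e' M L^2 <= (e / 2)^2]. *)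
have [L [L0 LE]] : exists L, 0 <= L /\ L = b * (n.+1%:R * B).
  by exists (b * (n.+1%:R * B)); rewrite !mulr_ge0 ?ler0n.
have e'0 : 0 < (e / 2) ^+ 2 / (M * L ^+ 2 + 1).
  by rewrite divr_gt0 // ltr_wpDl // mulr_ge0 ?sqr_ge0.
have [J' hJ'] := resolvent_exists e'0.
have middle k : `|ip (app S (u k)) (J n (v k)) - ip (app S (J' (u k))) (J n (v k))| <= e / 2.
  have DJ' := resolvent_dom hJ' (u k); have DJ := resolvent_dom (hJ n) (v k).
  rewrite !hSa //; [|exact: (AS _ DJ').1|exact: (AS _ (Du k)).1].
  rewrite -ipBl; apply: le_trans (cauchy_schwarz _ _) _.
  have h1 : hnorm (Sa (J n (v k))) <= L.
    apply: le_trans (hSab _ DJ) _; rewrite LE ler_wpM2l //.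
    apply: le_trans (hnorm_app_resolvent (hJ n) _) _.
    by rewrite invrK ler_wpM2l ?ler0n.
  apply: le_trans (ler_wpM2l (hnorm_ge0 _) h1) _.
  have e20 : 0 <= e / 2 by lra.
  rewrite -(@ler_pXn2r _ 2) // ?nnegrE ?(mulr_ge0 (hnorm_ge0 _) L0) ?e20 // exprMn.
  apply: le_trans (ler_wpM2r (sqr_ge0 L) (hnorm_sub_resolvent_form hJ' (Du k))) _.
  apply: le_trans (ler_wpM2r (sqr_ge0 L) (ler_wpM2l (ltW e'0) (hM k))) _.
  have ML := mulr_ge0 M0 (sqr_ge0 L).
  rewrite -mulrA mulrAC ler_pdivrMr ?ltr_wpDl // ler_pM2l //; lra.
exists (fun k => ip (app S (J' (u k))) (J n (v k))); last first.
  by move=> k; have := ler_distD (ip (app S (u k)) (J n (v k))) (ip (app S (u k)) (v k))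
    (ip (app S (J' (u k))) (J n (v k))); have := tail k; have := middle k; lra.
have wJ : wnull (fun k => J' (u k)).
  by move=> y; apply: rnull_le (wu (J' y)) => k; rewrite (resolvent_sym hJ').
have nS : rnull (fun k => hnorm (app S (J' (u k)))).
  apply: (rel_compact_wnull (u := fun k => J' (u k)) lA lSA cS) => //.
  - by move=> k; exact: resolvent_dom hJ' _.
  - by exists Bu => k; apply: le_trans (hnorm_resolvent hJ' _) (hBu k).
  - eexists => k; apply: le_trans (hnorm_app_resolvent hJ' _) _.
    by apply: ler_wpM2l (hBu k); rewrite invr_ge0 ltW.
  (* [A J' u_k = (u_k - J' u_k) / e'] is a combination of weakly null sequences. *)
  - move=> y; apply: rnull_le (rnullZ _ (rnullB (wu y) (wJ y))) => k.
    by rewrite (app_resolvent hJ') ipZl ipBl.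
apply: rnull_le (rnull_bounded_mul nS (g := fun k => hnorm (J n (v k))) (M := B) _) => k.
  by rewrite [leRHS]ger0_norm ?mulr_ge0 ?hnorm_ge0 // cauchy_schwarz.
by rewrite ger0_norm ?hnorm_ge0 // (le_trans (hnorm_resolvent (hJ n) _)).
Qed.
End Resolvent.

(** * Both compactness hypotheses reduced to form compactness *)

Theorem theorem4p7 (R : realType) (H : Hilbert R) (A B S Q : op H) :
  uniformly_positive A -> op_symmetric B -> linop S -> is_pos_sqrt Q A ->
  (* main statement: dom(A^{1/2}) ⊂ dom(S) and A^{-1/2} S is A^{1/2}-compact *)
  ((forall x, dom Q x -> dom S x) ->
   rel_compact Q (op_comp (op_inv Q) S) ->
   forall lam : R[i], W_e (op_AiB A B) lam <-> W_e (op_add (op_AiB A B) S) lam) /\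
  (* "in particular": S is A-compact and dom(A) ⊂ dom(S) ∩ dom(S^* ) *)
  (rel_compact A S ->
   (forall x, dom A x -> dom S x /\ adj_dom S x) ->
   forall lam : R[i], W_e (op_AiB A B) lam <-> W_e (op_add (op_AiB A B) S) lam).
Proof.
move=> pA sB lS sQ; have lA := pA.1.1; have [c cA] := uniformly_positive_coercive pA.
split=> [QS cS|cS AS]; apply: W_e_form_compact => //.
- by move=> x /sQ.2.2.1 [/QS].
- exact: form_compact_sqrt sQ lS QS cS.
- by move=> x /AS[].
- exact: (form_compact_rel_compact pA.1 cA).
Qed.
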